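(* Let $G$ be a finite undirected bipartite graph with $n$ vertices that is $P_7$-free. Then the Efficient Domination problem for $G$ (deciding whether $G$ has an efficient dominating set) can be solved in time $O(n^4)$.
   Context: For a graph $G=(V,E)$ and $v\in V$, $N[v]$ denotes the closed neighborhood of $v$ ($v$ together with its neighbors). A set $D\subseteq V$ is an efficient dominating set (e.d.s.) of $G$ if $|N[v]\cap D|=1$ for every $v\in V$. The Efficient Domination (ED) problem asks, given $G$, whether $G$ has an e.d.s. $P_k$ denotes the chordless path on $k$ vertices; a graph is $H$-free if it contains no induced subgraph isomorphic to $H$. *)

(* Defs.v *)
From HB Require Import structures.
From mathcomp Require Import all_boot.

Set Implicit Arguments.
Unset Strict Implicit.
Unset Printing Implicit Defensive.

(** * Graphs *)

(** Finite undirected simple graphs with vertex set {0, ..., n-1}. *)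
Record graph (n : nat) := Graph {
  adj :> rel 'I_n;
  adj_sym : symmetric adj;
  adj_irr : irreflexive adj }.

Definition closed_nbhd n (G : graph n) (v : 'I_n) : {set 'I_n} :=
  [set u | (u == v) || G v u].

Definition efficient_dominating n (G : graph n) (D : {set 'I_n}) : bool :=
  [forall v, #|closed_nbhd G v :&: D| == 1].

Definition has_eds n (G : graph n) : bool :=
  [exists D : {set 'I_n}, efficient_dominating G D].

Definition bipartite n (G : graph n) : Prop :=
  exists A : {set 'I_n}, forall u v, G u v -> (u \in A) != (v \in A).

Definition induced_subgraph k n (H : graph k) (G : graph n) : Prop :=
  exists2 f : 'I_k -> 'I_n, injective f & forall i j, G (f i) (f j) = H i j.

Definition free k n (H : graph k) (G : graph n) : Prop :=
  ~ induced_subgraph H G.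

Definition path_adj k : rel 'I_k := fun i j => (i.+1 == j) || (j.+1 == i).

Lemma path_adj_sym k : symmetric (@path_adj k).
Proof. by move=> i j; rewrite /path_adj orbC. Qed.

Lemma path_adj_irr k : irreflexive (@path_adj k).
Proof. by move=> i; rewrite /path_adj orbb -[X in _ == X]addn0 -addn1 eqn_add2l. Qed.

(** The chordless path on [k] vertices. *)
Definition P_ k : graph k := Graph (@path_adj_sym k) (@path_adj_irr k).

(** * Word RAM

    Time is measured on a word RAM, presented as a structured imperative
    language over registers and a random-access memory, all of whose cells
    hold words of [w] bits.  Every constant, register access, memory access,
    arithmetic operation, comparison, assignment and branching test costs one
    unit of time. *)

Inductive op := Add | Sub | Mul | Div | Mod | Lt | Eq.

Inductive expr :=
  | Const of nat
  | Reg of nat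
  | Read of expr
  | Op of op & expr & expr.

Inductive cmd :=
  | Skip
  | Assign of nat & expr
  | Write of expr & expr
  | Seq of cmd & cmd
  | If of expr & cmd & cmd
  | While of expr & cmd.

Record state := State { reg : nat -> nat; mem : nat -> nat }.

Definition update (f : nat -> nat) (a x : nat) : nat -> nat :=
  fun b => if b == a then x else f b.

Definition set_reg (s : state) (r x : nat) : state :=
  State (update (reg s) r x) (mem s).

Definition set_mem (s : state) (a x : nat) : state :=
  State (reg s) (update (mem s) a x).

(** Overflow wraps around modulo [2 ^ w]; subtraction is truncated at 0, and
    [x %/ 0 = 0], [x %% 0 = x]. *)
Definition eval_op (w : nat) (o : op) (x y : nat) : nat :=
  match o with
  | Add => (x + y) %% 2 ^ w
  | Sub => x - y
  | Mul => (x * y) %% 2 ^ w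
  | Div => x %/ y
  | Mod => x %% y
  | Lt => x < y
  | Eq => x == y
  end.

Fixpoint eval (w : nat) (s : state) (e : expr) : nat :=
  match e with
  | Const c => c %% 2 ^ w
  | Reg r => reg s r
  | Read a => mem s (eval w s a)
  | Op o e1 e2 => eval_op w o (eval w s e1) (eval w s e2)
  end.

Fixpoint expr_cost (e : expr) : nat :=
  match e with
  | Const _ | Reg _ => 1
  | Read a => (expr_cost a).+1
  | Op _ e1 e2 => (expr_cost e1 + expr_cost e2).+1
  end.

(** [exec w c s t s'] : started in [s], [c] halts in [s'] after [t] units of
    time. *)
Inductive exec (w : nat) : cmd -> state -> nat -> state -> Prop :=
  | ExecSkip s : exec w Skip s 1 s
  | ExecAssign r e s :
      exec w (Assign r e) s (expr_cost e).+1 (set_reg s r (eval w s e))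
  | ExecWrite a e s :
      exec w (Write a e) s (expr_cost a + expr_cost e).+1
        (set_mem s (eval w s a) (eval w s e))
  | ExecSeq c1 c2 s s1 s2 t1 t2 :
      exec w c1 s t1 s1 -> exec w c2 s1 t2 s2 ->
      exec w (Seq c1 c2) s (t1 + t2) s2
  | ExecIfTrue e c1 c2 s s1 t :
      eval w s e != 0 -> exec w c1 s t s1 ->
      exec w (If e c1 c2) s (expr_cost e + t).+1 s1
  | ExecIfFalse e c1 c2 s s1 t :
      eval w s e = 0 -> exec w c2 s t s1 ->
      exec w (If e c1 c2) s (expr_cost e + t).+1 s1
  | ExecWhileTrue e c s s1 s2 t1 t2 :
      eval w s e != 0 -> exec w c s t1 s1 -> exec w (While e c) s1 t2 s2 ->
      exec w (While e c) s (expr_cost e + t1 + t2).+1 s2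
  | ExecWhileFalse e c s :
      eval w s e = 0 -> exec w (While e c) s (expr_cost e).+1 s.

(** Execution is deterministic, so "some halting execution takes time [t]"
    means "the execution halts in time [t]". *)
Lemma exec_det w c s t1 s1 t2 s2 :
  exec w c s t1 s1 -> exec w c s t2 s2 -> t1 = t2 /\ s1 = s2.
Proof.
move=> H; elim: H t2 s2 => {c s t1 s1};
  intros; match goal with H : exec _ _ _ _ _ |- _ => inversion H; subst end;
  try congruence;
  repeat match goal with
  | IH : forall t s, exec ?w ?c ?s0 t s -> _, H : exec ?w ?c ?s0 _ _ |- _ =>
      case: (IH _ _ H) => ? ?; subst; clear H
  | H : is_true (?x != 0), H' : ?x = 0 |- _ => by rewrite H' in H
  end; by [].
Qed.

(** * Solving graph problems *)

(** Row-major adjacency matrix: cell [i * n + j] holds the bit [G i j] for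
    [i, j < n]; all other cells hold 0. *)
Definition adj_mem n (G : graph n) (a : nat) : nat :=
  [exists i : 'I_n, exists j : 'I_n, (a == i * n + j) && G i j].

(** Register 0 initially holds the number of vertices. *)
Definition input n (G : graph n) : state :=
  State (fun r => if r == 0 then n else 0) (adj_mem G).

(** Words of [Theta(log n)] bits; [trunc_log 2 n] is the floor of log2 [n]. *)
Definition word_size (k n : nat) : nat := k * (trunc_log 2 n).+1.

Definition is_O (T f : nat -> nat) : Prop :=
  exists c n0, forall n, n0 <= n -> T n <= c * f n.

(** One fixed program, on words of size [word_size k n] for some constant
    [k > 0], halts on every [n]-vertex graph [G] of the class [C] in time at most [T n],
    where [T] is O([f]), with the truth value of [Q G] in register 0. *)
Definition solvable_in_time (C : forall n, graph n -> Prop)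
    (Q : forall n, graph n -> bool) (f : nat -> nat) : Prop :=
  exists (p : cmd) (k : nat) (T : nat -> nat), 0 < k /\ is_O T f /\
    forall n (G : graph n), C n G ->
      exists t s, [/\ exec (word_size k n) p (input G) t s,
                      t <= T n & reg s 0 = Q n G].

(* Main.v *)
Require Import Defs.
From mathcomp Require Import all_boot.
From mathcomp Require Import zify.

Set Implicit Arguments.
Unset Strict Implicit.
Unset Printing Implicit Defensive.

(** Let [D] be an e.d.s. of a connected bipartite P7-free graph, [v] in [D], and let
    [N_i] be the set of vertices at distance [i] from [v]; so [N_6] is empty and [D]
    meets neither [N_1] nor [N_2].  Joining two vertices of [D] through the lower
    levels gives a P7 unless at most one vertex of [D] in [N_3] has a neighbour in
    [N_4], and at most one vertex of [D] in [N_4] has a neighbour in [N_5].  If there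
    is such a vertex [d] in [N_3], then [d] has eccentricity at most 4, and we take
    [d] as the new centre [v].  Hence some [v] in [D] has at most one [x] in [D] at
    distance at least 3 with a neighbour on the next level.  Then [D] consists of [v],
    [x] (if it exists) and the vertices at distance at least 3 that are not adjacent
    to [x] and have no neighbour on the next level.  For each of the [n ^ 2] pairs
    [(v, x)] it takes time O([n ^ 2]) to test whether this candidate is an e.d.s. of
    the component of [v]. *)

(** * Efficient dominating sets and distance levels *)

Lemma connect_sym_adj n (G : graph n) : connect_sym G.
Proof. by apply: sym_connect_sym; apply: adj_sym. Qed.

Section BipartiteP7Free.

Variables (n : nat) (G : graph n) (A : {set 'I_n}).
Hypothesis bipA : forall u v, G u v -> (u \in A) != (v \in A).
Hypothesis P7free : free (P_ 7) G.

Lemma edgeC a b : G a b = G b a. Proof. exact: adj_sym. Qed.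

Lemma no_P7 p0 p1 p2 p3 p4 p5 p6 :
  G p0 p1 -> G p1 p2 -> G p2 p3 -> G p3 p4 -> G p4 p5 -> G p5 p6 ->
  ~~ G p0 p3 -> ~~ G p0 p5 -> ~~ G p1 p4 -> ~~ G p1 p6 -> ~~ G p2 p5 ->
  ~~ G p3 p6 -> False.
Proof.
move=> e01 e12 e23 e34 e45 e56 n03 n05 n14 n16 n25 n36; apply: P7free.
pose f (i : 'I_7) := nth p0 [:: p0; p1; p2; p3; p4; p5; p6] i.
have same a b c : G a b -> G b c -> G a c = false.
  move=> /bipA ab /bipA bc; apply/negP => /bipA; move: ab bc.
  by case: (a \in A); case: (b \in A); case: (c \in A).
have same4 a b c d e : G a b -> G b c -> G c d -> G d e -> G a e = false.
  move=> /bipA ab /bipA bc /bipA cd /bipA de; apply/negP => /bipA.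
  move: ab bc cd de; case: (a \in A); case: (b \in A); case: (c \in A);
    by case: (d \in A); case: (e \in A).
have n02 := same _ _ _ e01 e12; have n13 := same _ _ _ e12 e23.
have n24 := same _ _ _ e23 e34; have n35 := same _ _ _ e34 e45.
have n46 := same _ _ _ e45 e56; have n04 := same4 _ _ _ _ _ e01 e12 e23 e34.
have n15 := same4 _ _ _ _ _ e12 e23 e34 e45.
have n26 := same4 _ _ _ _ _ e23 e34 e45 e56.
have n06 : G p0 p6 = false.
  apply/negP => /bipA; move: (bipA e01) (bipA e12) (bipA e23) (bipA e34).
  move: (bipA e45) (bipA e56); case: (p0 \in A); case: (p1 \in A);
    case: (p2 \in A); case: (p3 \in A); case: (p4 \in A); case: (p5 \in A);
    by case: (p6 \in A).
have lt (i j : 'I_7) : i < j -> G (f i) (f j) = (i.+1 == j).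
  move: (ltn_ord i) (ltn_ord j); rewrite /f.
  move: (nat_of_ord i) (nat_of_ord j) => {}i {}j.
  case: i => [|[|[|[|[|[|[|//]]]]]]]; case: j => [|[|[|[|[|[|[|//]]]]]]] //= _ _ _;
    by [assumption | apply/negbTE].
have fE i j : G (f i) (f j) = P_ 7 i j.
  rewrite /= /path_adj; case: (ltngtP i j) => [ij|ji|/val_inj->].
  - by rewrite lt // [j.+1 == _]gtn_eqF ?orbF // ltnW.
  - by rewrite edgeC lt // [i.+1 == _]gtn_eqF // ltnW.
  - by rewrite adj_irr (gtn_eqF (ltnSn _)).
exists f => // i j fij.
have twins (k l : 'I_7) : f k = f l -> k < l -> False.
  move=> fkl kl; have eqN m : P_ 7 k m = P_ 7 l m by rewrite -!fE fkl.
  have l7 := ltn_ord l; move: eqN; rewrite /= /path_adj.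
  case: (posnP k) => [k0|kpos] eqN.
    have := eqN (Ordinal (isT : 1 < 7)); rewrite k0 /= => l2.
    have := eqN (Ordinal (isT : 3 < 7)); rewrite k0 /= => l3.
    by move: kl l2 l3; rewrite k0; case: (nat_of_ord l) => [|[|[|]]].
  have km : k.-1 < 7 by rewrite (leq_ltn_trans (leq_pred k)).
  by have := eqN (Ordinal km); rewrite /= prednK // eqxx orbT => /esym/orP[] /eqP; clear -kl kpos; lia.
by apply: val_inj; case: (ltngtP i j) => // /twins; case.
Qed.

(* [L] is one plus the distance to [v], and 0 outside the component of [v]. *)
Definition is_level v (L : 'I_n -> nat) :=
  [/\ L v = 1, forall u, L u <= 6, forall u, L u = 1 -> u = v,
      forall u k, L u = k.+2 -> exists2 u', G u u' & L u' = k.+1 &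
      forall a b, G a b -> L a != 0 -> 0 < L b <= (L a).+1].

Section Level.

Variables (v : 'I_n) (L : 'I_n -> nat).
Hypothesis levL : is_level v L.

Lemma level_root : L v = 1. Proof. by case: levL. Qed.

Lemma level_le6 u : L u <= 6. Proof. by case: levL. Qed.

Lemma level_eq1 u : L u = 1 -> u = v. Proof. by case: levL => _ _ + _ _; apply. Qed.

Lemma level_down u k : L u = k.+2 -> exists2 u', G u u' & L u' = k.+1.
Proof. by case: levL => _ _ _ + _; apply. Qed.

Lemma level_color u : L u != 0 -> (u \in A) = (v \in A) (+) ~~ odd (L u).
Proof.
move Dk: (L u) => k; elim: k u Dk => // -[|k] IH u Lu _.
  by rewrite (level_eq1 Lu) addbF.
have [u' /bipA uu' Lu'] := level_down Lu.
move: uu'; rewrite (IH _ Lu') //=.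
by case: (u \in A); case: (v \in A); case: (odd k).
Qed.

Lemma level_edge a b : G a b -> L a != 0 -> L b = (L a).+1 \/ L a = (L b).+1.
Proof.
case: levL => _ _ _ _ nbL ab La.
have /andP[Lb leb] := nbL _ _ ab La; have Lb0 : L b != 0 by rewrite -lt0n.
have ba : G b a by rewrite edgeC.
have /andP[_ lea] := nbL _ _ ba Lb0.
have : odd (L a) != odd (L b).
  have := bipA ab; rewrite (level_color La) (level_color Lb0).
  by case: (v \in A); case: (odd (L a)); case: (odd (L b)).
clear -leb lea; case: (ltngtP (L a) (L b)) => [||->]; rewrite ?eqxx //; lia.
Qed.

Lemma level_nonadj a b i j : L a = i -> L b = j ->
  [&& i != 0, j != i.+1 & i != j.+1] -> ~~ G a b.
Proof.
move=> <- <- /and3P[La n1 n2].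
by apply/negP => /level_edge /(_ La) [] /eqP; apply/negP.
Qed.

Lemma level_down_edge u k : L u = k.+2 -> exists2 u', G u' u & L u' = k.+1.
Proof. by case/level_down=> u' uu' Lu'; exists u'; rewrite // edgeC. Qed.

Lemma level_connect u : (L u != 0) = connect G v u.
Proof.
apply/idP/connectP => [|[p]].
  move Dk: (L u) => k; elim: k u Dk => // -[|k] IH u Lu _.
    by exists [::]; rewrite // (level_eq1 Lu).
  have [u' u'u Lu'] := level_down_edge Lu; have [p vp lp] := IH _ Lu' isT.
  by exists (rcons p u); rewrite ?last_rcons // rcons_path vp -lp.
suff closed x : L x != 0 -> path G x p -> L (last x p) != 0.
  by move=> vp ->; apply: closed; rewrite // level_root.
elim: p x => [|y p IHp] x Lx //= /andP[xy]; apply: IHp.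
by case: levL => _ _ _ _ /(_ x y xy Lx); rewrite lt0n => /andP[].
Qed.

End Level.

Variable D : {set 'I_n}.
Hypothesis edsD : efficient_dominating G D.

Lemma eds_dominated u : exists2 x, x \in D & (x == u) || G u x.
Proof.
have /cards1P[x xP] := forallP edsD u.
have : x \in closed_nbhd G u :&: D by rewrite xP set11.
by rewrite !inE => /andP[ux xD]; exists x.
Qed.

Lemma eds_unique u x y : x \in D -> y \in D ->
  (x == u) || G u x -> (y == u) || G u y -> x = y.
Proof.
have /cards1P[z zP] := forallP edsD u.
move=> xD yD ux uy.
have : x \in closed_nbhd G u :&: D by rewrite !inE ux.
have : y \in closed_nbhd G u :&: D by rewrite !inE uy.
by rewrite zP !inE => /eqP-> /eqP->.
Qed.

Lemma eds_nonadj x y : x \in D -> y \in D -> ~~ G x y.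
Proof.
move=> xD yD; apply/negP => xy.
have E : x = y by apply: (@eds_unique x); rewrite ?eqxx ?xy ?orbT.
by move: xy; rewrite E adj_irr.
Qed.

Lemma eds_private u x y : x \in D -> y \in D -> x <> y -> G u x -> ~~ G u y.
Proof.
move=> xD yD xy ux; apply/negP => uy; apply: xy.
by apply: (@eds_unique u); rewrite ?ux ?uy ?orbT.
Qed.

Section Centre.

Variables (v : 'I_n) (L : 'I_n -> nat).
Hypotheses (levL : is_level v L) (vD : v \in D).

Local Ltac by_level := apply: (level_nonadj levL); [eassumption | eassumption | by []].

Lemma eds_level_small u : u \in D -> 0 < L u <= 3 -> u = v.
Proof.
move=> uD; case Lu: (L u) => [|[|[|[|//]]]] // _; first exact: level_eq1 levL _ Lu.
  have [u' uu' /(level_eq1 levL) u'v] := level_down levL Lu.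
  by move: (eds_nonadj uD vD); rewrite -u'v uu'.
have [u1 uu1 Lu1] := level_down levL Lu.
have [u2 u12 /(level_eq1 levL) u2v] := level_down levL Lu1.
by apply: (@eds_unique u1) => //; rewrite -?u2v ?u12 1?edgeC ?uu1 orbT.
Qed.

Lemma eds_level3_common d d' x x' : d \in D -> d' \in D -> d <> d' ->
  L d = 4 -> L d' = 4 -> L x = 3 -> L x' = 3 -> G x d -> G x' d' ->
  exists u, [/\ G u x, G u x' & L u = 2].
Proof.
move=> dD d'D dd' Ld Ld' Lx Lx' xd x'd'.
have [u ux Lu] := level_down_edge levL Lx.
have [u' ux' Lu'] := level_down_edge levL Lx'.
have [ux2|nux'] := boolP (G u x'); first by exists u.
have [u'x|nu'x] := boolP (G u' x); first by exists u'.
have nxd' : ~~ G x d' by apply: eds_private xd.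
have nx'd : ~~ G x' d by apply: eds_private x'd' => // /esym.
have [t tu /(level_eq1 levL) tv] := level_down_edge levL Lu.
have [t' tu' /(level_eq1 levL) tv'] := level_down_edge levL Lu'.
have Lv := level_root levL; subst t t'.
exfalso; apply: (@no_P7 d x u v u' x' d') => //; rewrite 1?edgeC //; by_level.
Qed.

Lemma eds_level3_unique d d' e e' : d \in D -> d' \in D ->
  L d = 4 -> L d' = 4 -> G d e -> G d' e' -> L e = 5 -> L e' = 5 -> d = d'.
Proof.
move=> dD d'D Ld Ld' de de' Le Le'; apply/eqP/negPn/negP => /eqP dd'.
have [x xd Lx] := level_down_edge levL Ld.
have [x' xd' Lx'] := level_down_edge levL Ld'.
have [u [ux ux' Lu]] := eds_level3_common dD d'D dd' Ld Ld' Lx Lx' xd xd'.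
have dd2 : d' <> d by move/esym.
have n1 : ~~ G e d' by apply: eds_private dd' _; rewrite 1?edgeC.
have n2 : ~~ G x' d by apply: eds_private dd2 _.
have n3 : ~~ G e' d by apply: eds_private dd2 _; rewrite 1?edgeC.
have n4 : ~~ G x d' by apply: eds_private dd' _.
apply: (@no_P7 e d x u x' d' e') => //; try (by rewrite edgeC); by_level.
Qed.

Lemma eds_level4_unique z1 z2 w1 w2 : z1 \in D -> z2 \in D ->
  L z1 = 5 -> L z2 = 5 -> G z1 w1 -> G z2 w2 -> L w1 = 6 -> L w2 = 6 -> z1 = z2.
Proof.
move=> z1D z2D Lz1 Lz2 zw1 zw2 Lw1 Lw2; apply/eqP/negPn/negP => /eqP z12.
have z21 : z2 <> z1 by move/esym.
have [y1 yz1 Ly1] := level_down_edge levL Lz1.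
have [y2 yz2 Ly2] := level_down_edge levL Lz2.
have [x1 xy1 Lx1] := level_down_edge levL Ly1.
have [x2 xy2 Lx2] := level_down_edge levL Ly2.
have [u1 ux1 Lu1] := level_down_edge levL Lx1.
have [u2 ux2 Lu2] := level_down_edge levL Lx2.
have [v1 vu1 /(level_eq1 levL) E1] := level_down_edge levL Lu1.
have [v2 vu2 /(level_eq1 levL) E2] := level_down_edge levL Lu2.
have Lv := level_root levL; subst v1 v2.
have ny1 : ~~ G y1 z2 by apply: eds_private z12 _.
have ny2 : ~~ G y2 z1 by apply: eds_private z21 _.
have nw1 : ~~ G w1 z2 by apply: eds_private z12 _; rewrite 1?edgeC.
have nw2 : ~~ G w2 z1 by apply: eds_private z21 _; rewrite 1?edgeC.
have share x : L x = 3 -> G x y1 -> G x y2 -> False.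
  move=> Lx xy1' xy2'.
  apply: (@no_P7 w1 z1 y1 x y2 z2 w2) => //; try (by rewrite edgeC); by_level.
have nxy1 : ~~ G x1 y2 by apply/negP => xy; apply: (share x1).
have nxy2 : ~~ G x2 y1 by apply/negP => xy; apply: (share x2).
have share' u : L u = 2 -> G u x1 -> G u x2 -> False.
  move=> Lu u_x1 u_x2.
  apply: (@no_P7 z1 y1 x1 u x2 y2 z2) => //; try (by rewrite edgeC); by_level.
have nux1 : ~~ G u1 x2 by apply/negP => ux; apply: (share' u1).
have nux2 : ~~ G u2 x1 by apply/negP => ux; apply: (share' u2).
apply: (@no_P7 z1 y1 x1 u1 v u2 x2) => //; try (by rewrite edgeC); by_level.
Qed.

(* An edge above [d] turns a shortest path of length 5 from [d] into a P7. *)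
Lemma eds_level3_eccentricity d e Ld : d \in D -> L d = 4 -> G d e -> L e = 5 ->
  is_level d Ld -> forall u, Ld u <> 6.
Proof.
move=> dD d4 de e5 levLd u u6.
have step a b k : G a b -> 0 < Ld a <= k -> 0 < Ld b <= k.+1.
  rewrite lt0n => ab /andP[a0 ak]; case: levLd => _ _ _ _ /(_ a b ab a0) /andP[-> ba].
  exact: leq_trans ba _.
have Ldd : 0 < Ld d <= 1 by rewrite (level_root levLd).
have back a b k : 0 < Ld a <= k -> G b a -> 0 < Ld b <= k.+1.
  by rewrite edgeC => ? /step; apply.
have [x xd Lx] := level_down_edge levL d4.
have par a : Ld a != 0 -> L a != 0 -> odd (Ld a) = ~~ odd (L a).
  move=> da la; have := level_color levL la; rewrite (level_color levLd da).
  rewrite (level_color levL (u := d)) d4 //=.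
  by case: (v \in A); case: (odd (Ld a)); case: (odd (L a)).
have conn k a : Ld a = k -> k != 0 -> L a != 0.
  elim: k a => // -[|k] IH a ak _.
    by rewrite (level_eq1 levLd ak) d4.
  have [a' aa' Da'] := level_down levLd ak.
  have a'0 := IH _ Da' isT.
  by case: levL => _ _ _ _ /(_ a' a); rewrite edgeC => /(_ aa' a'0) /andP[+ _]; rewrite lt0n.
have Lu0 := conn _ _ u6 isT.
have oddu : odd (L u) by have := par u; rewrite u6 Lu0 /= => /(_ isT isT) /esym/negbFE.
have lvl4 d' x' : d' \in D -> L x' = 3 -> G x' d' -> L d' = 4.
  move=> d'D Lx' x'd'; case: (level_edge levL x'd'); rewrite ?Lx' // => -[Ld'].
  have d'v : d' = v by apply: eds_level_small; rewrite // -Ld'.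
  by move: (level_root levL); rewrite -d'v -Ld'.
have lvl3 x' : L x' = 3 -> 0 < Ld x' <= 4.
  move=> Lx'; have [d' d'D /predU1P[d'x'|x'd']] := eds_dominated x'.
    have := @eds_level_small d' d'D; rewrite d'x' Lx' => /(_ isT) E.
    by move: (level_root levL); rewrite -E Lx'.
  have [E|/eqP dd'] := eqVneq d d'.
    have x'd : G x' d by rewrite E.
    have /andP[-> Ldx'] := back _ _ _ Ldd x'd.
    exact: leq_trans Ldx' _.
  have d'4 := lvl4 _ _ d'D Lx' x'd'.
  have [u0 [u0x u0x' _]] := eds_level3_common dD d'D dd' d4 d'4 Lx Lx' xd x'd'.
  exact: step u0x' (back _ _ _ (back _ _ _ Ldd xd) u0x).
case Lu: (L u) oddu Lu0 => [|[|[|[|[|[|[|k]]]]]]] // _ _.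
- have [u0 u0x Lu0] := level_down_edge levL Lx.
  have [t tu /(level_eq1 levL) tv] := level_down_edge levL Lu0.
  have := back _ _ _ (back _ _ _ (back _ _ _ Ldd xd) u0x) tu.
  by rewrite tv -(level_eq1 levL Lu) u6.
- by have := lvl3 _ Lu; rewrite u6.
- have [y yu Ly] := level_down_edge levL Lu.
  have [x' x'y Lx'] := level_down_edge levL Ly.
  have near a : G d a -> ~~ G a y.
    move=> da; apply/negP => ay; have := step _ _ _ yu (step _ _ _ ay (step _ _ _ da Ldd)).
    by rewrite u6.
  have nx'd : ~~ G x' d by apply/negP => x'd; move: (near x'); rewrite edgeC x'd x'y => /(_ isT).
  have [d' d'D /predU1P[d'x'|x'd']] := eds_dominated x'.
    have := @eds_level_small d' d'D; rewrite d'x' Lx' => /(_ isT) E.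
    by move: (level_root levL); rewrite -E Lx'.
  have dd' : d <> d' by move=> E; move: nx'd; rewrite E x'd'.
  have d'4 := lvl4 _ _ d'D Lx' x'd'.
  have [u0 [u0x u0x' Lu0]] := eds_level3_common dD d'D dd' d4 d'4 Lx Lx' xd x'd'.
  have nxy : ~~ G x y by apply: near; rewrite edgeC.
  have ney : ~~ G e y by apply: near.
  have nud : ~~ G u d.
    by apply/negP => ud; have := back _ _ _ Ldd ud; rewrite u6.
  apply: (@no_P7 u y x' u0 x d e) => //; try (by rewrite edgeC); by_level.
- by have := level_le6 levL u; rewrite Lu.
Qed.

Definition above u : bool := [exists b, G u b && (L b == (L u).+1)].

(* Every vertex of level at least 4 that is not in [D] and has no neighbour on the
   next level is dominated from the level below, hence by [g]. *)
Lemma eds_candidate g : g \in D ->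
  (forall u, u \in D -> 3 < L u -> above u -> u = g) ->
  forall u, L u != 0 ->
  (u \in D) = [|| u == v, u == g | [&& 3 < L u, ~~ above u & ~~ G u g]].
Proof.
move=> gD gP u Lu; apply/idP/idP => [uD|].
  have [L3|L3] := ltnP 3 (L u); last first.
    by rewrite (eds_level_small uD) ?eqxx // lt0n Lu.
  have [ab|nab] := boolP (above u); first by rewrite (gP u uD L3 ab) eqxx orbT.
  by rewrite (eds_nonadj uD gD) !orbT.
case/or3P=> [/eqP->//|/eqP->//|/and3P[L3 nab nug]].
have [x xD /predU1P[<-//|ux]] := eds_dominated u.
have nx : L x != (L u).+1.
  by apply: contra nab => Lx; apply/existsP; exists x; rewrite ux.
case: (level_edge levL ux Lu) => [/eqP|E]; first by rewrite (negbTE nx).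
have [L3x|L3x] := ltnP 3 (L x).
  have xg : x = g.
    by apply: gP => //; apply/existsP; exists u; rewrite edgeC ux E eqxx.
  by rewrite -xg ux in nug.
have x0 : 0 < L x by move: L3; rewrite E; case: (L x).
have xv := eds_level_small xD (introT andP (conj x0 L3x)).
by move: L3; rewrite E xv (level_root levL).
Qed.

End Centre.

Lemma eds_search (Lf : 'I_n -> 'I_n -> nat) a : (forall v, is_level v (Lf v)) ->
  exists v g, [/\ v \in D, g \in D, Lf v a != 0 &
    forall u, u \in D -> 3 < Lf v u -> above (Lf v) u -> u = g].
Proof.
move=> levs; have [v vD dom] := eds_dominated a.
have va : Lf v a != 0.
  rewrite (level_connect (levs v)); case/predU1P: dom => [->|av]; first exact: connect0.
  by apply: connect1; rewrite edgeC.
have le6 x u := level_le6 (levs x) u.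
have [/existsP[d /and3P[dD /eqP Ld dab]]|no3] :=
  boolP [exists d, [&& d \in D, Lf v d == 4 & above (Lf v) d]].
  have /existsP[e /andP[de /eqP Le]] := dab; rewrite Ld in Le.
  have ecc := eds_level3_eccentricity (levs v) vD dD Ld de Le (levs d).
  have da : Lf d a != 0.
    move: va; rewrite (level_connect (levs d)) (level_connect (levs v)).
    move=> va; apply: connect_trans va; rewrite (connect_sym_adj G).
    by rewrite -(level_connect (levs v)) Ld.
  have only4 u : 3 < Lf d u -> above (Lf d) u ->
      Lf d u = 4 /\ exists2 b, G u b & Lf d b = 5.
    move=> L3 /existsP[b /andP[ub /eqP Lb]]; have := le6 d b; have := ecc b.
    have E : Lf d u = 4 \/ Lf d b = 6 \/ 6 < Lf d b.
      by rewrite Lb; move: L3; clear; lia.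
    case: E => [E _ _|[//|E _]]; last by rewrite leqNgt E.
    by split=> //; exists b; rewrite // Lb E.
  have [/existsP[x /and3P[xD L3 xab]]|no] :=
    boolP [exists x, [&& x \in D, 3 < Lf d x & above (Lf d) x]].
    exists d, x; split=> // u uD Lu uab.
    have [Lu4 [b ub Lb]] := only4 u Lu uab; have [Lx4 [c xc Lc]] := only4 x L3 xab.
    exact: (eds_level3_unique (levs d) uD xD Lu4 Lx4 ub xc Lb Lc).
  exists d, d; split=> // u uD Lu uab; case/existsP: no; exists u.
  by rewrite uD Lu.
have only5 u : u \in D -> 3 < Lf v u -> above (Lf v) u ->
    Lf v u = 5 /\ exists2 b, G u b & Lf v b = 6.
  move=> uD L3 uab; have /existsP[b /andP[ub /eqP Lb]] := uab; have := le6 v b.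
  have E : Lf v u = 4 \/ Lf v u = 5 \/ 6 < Lf v b.
    by rewrite Lb; move: L3; clear; lia.
  case: E => [E|[E|E]] b6.
  - by case/existsP: no3; exists u; rewrite uD E eqxx.
  - by split=> //; exists b; rewrite // Lb E.
  - by move: b6; rewrite leqNgt E.
have [/existsP[x /and3P[xD L3 xab]]|no] :=
  boolP [exists x, [&& x \in D, 3 < Lf v x & above (Lf v) x]].
  exists v, x; split=> // u uD Lu uab.
  have [Lu5 [b ub Lb]] := only5 u uD Lu uab; have [Lx5 [c xc Lc]] := only5 x xD L3 xab.
  exact: (eds_level4_unique (levs v) uD xD Lu5 Lx5 ub xc Lb Lc).
exists v, v; split=> // u uD Lu uab; case/existsP: no; exists u.
by rewrite uD Lu.
Qed.
End BipartiteP7Free.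

(** * Programs with bounded loops *)

(* [PFor i p] runs [p] for [i = 0, ..., reg 0 - 1]. *)
Inductive prog :=
  | PAssign of nat & expr
  | PWrite of expr & expr
  | PSeq of prog & prog
  | PFor of nat & prog.

Fixpoint compile (p : prog) : cmd :=
  match p with
  | PAssign r e => Assign r e
  | PWrite a e => Write a e
  | PSeq p1 p2 => Seq (compile p1) (compile p2)
  | PFor i p => Seq (Assign i (Const 0))
      (While (Op Lt (Reg i) (Reg 0))
        (Seq (compile p) (Assign i (Op Add (Reg i) (Const 1)))))
  end.

Fixpoint run (w : nat) (p : prog) (s : state) : state :=
  match p with
  | PAssign r e => set_reg s r (eval w s e)
  | PWrite a e => set_mem s (eval w s a) (eval w s e)
  | PSeq p1 p2 => run w p2 (run w p1 s)
  | PFor i p =>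
      set_reg (iteri (reg s 0) (fun k s' => run w p (set_reg s' i k)) s) i (reg s 0)
  end.

Fixpoint assigned (p : prog) : seq nat :=
  match p with
  | PAssign r _ => [:: r]
  | PWrite _ _ => [::]
  | PSeq p1 p2 => assigned p1 ++ assigned p2
  | PFor i p => i :: assigned p
  end.

Fixpoint well_formed (p : prog) : bool :=
  match p with
  | PAssign r _ => r != 0
  | PWrite _ _ => true
  | PSeq p1 p2 => well_formed p1 && well_formed p2
  | PFor i p => [&& i != 0, i \notin assigned p & well_formed p]
  end.

Fixpoint cost (p : prog) (n : nat) : nat :=
  match p with
  | PAssign _ e => (expr_cost e).+1
  | PWrite a e => (expr_cost a + expr_cost e).+1
  | PSeq p1 p2 => cost p1 n + cost p2 n
  | PFor _ p => n * (cost p n + 8) + 6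
  end.

Fixpoint depth (p : prog) : nat :=
  match p with
  | PSeq p1 p2 => maxn (depth p1) (depth p2)
  | PFor _ p => (depth p).+1
  | _ => 0
  end.

Lemma run_frame w p s r : r \notin assigned p -> reg (run w p s) r = reg s r.
Proof.
elim: p s => [r' e|a e|p1 IH1 p2 IH2|i p IH] s //=.
- by rewrite inE /update => /negbTE->.
- by rewrite mem_cat negb_or => /andP[r1 r2]; rewrite IH2 // IH1.
rewrite inE negb_or => /andP[/negbTE ri rp]; rewrite /update ri.
by elim: (reg s 0) => //= k IHk; rewrite IH //= /update ri.
Qed.

Lemma well_formed_frame0 p : well_formed p -> 0 \notin assigned p.
Proof.
elim: p => [r e|//|p1 IH1 p2 IH2|i p IH] /=; rewrite ?inE; first by rewrite eq_sym.
  by rewrite mem_cat negb_or => /andP[/IH1-> /IH2->].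
by case/and3P=> i0 _ /IH p0; rewrite negb_or eq_sym i0.
Qed.

Lemma run_reg0 w p s : well_formed p -> reg (run w p s) 0 = reg s 0.
Proof. by move=> /well_formed_frame0; apply: run_frame. Qed.

Lemma run_iteri_reg0 w p i m s : well_formed p -> i != 0 ->
  reg (iteri m (fun k s' => run w p (set_reg s' i k)) s) 0 = reg s 0.
Proof.
move=> wfp i0; elim: m => //= m IHm; rewrite run_reg0 //= /update.
by rewrite eq_sym (negbTE i0).
Qed.

Lemma exec_compile w p s : well_formed p -> (reg s 0).+1 < 2 ^ w ->
  exists2 t, t <= cost p (reg s 0) & exec w (compile p) s t (run w p s).
Proof.
elim: p s => [r e|a e|p1 IH1 p2 IH2|i p IH] s /=.
- by move=> _ _; eexists; last exact: ExecAssign.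
- by move=> _ _; eexists; last exact: ExecWrite.
- case/andP=> wf1 wf2 hw; have [t1 le1 ex1] := IH1 s wf1 hw.
  have [] := IH2 (run w p1 s) wf2; rewrite run_reg0 // => t2 le2 ex2.
  by exists (t1 + t2); [exact: leq_add | exact: ExecSeq ex1 ex2].
case/and3P=> i0 ip wfp hw; set n := reg s 0 in hw *.
have i0' : (0 == i) = false by rewrite eq_sym (negbTE i0).
pose F k s' := run w p (set_reg s' i k).
have F0 m : reg (iteri m F s) 0 = n by apply: run_iteri_reg0.
have Fi m : reg (iteri m.+1 F s) i = m.
  by rewrite /= {1}/F run_frame //= /update eqxx.
have w1 : 1 %% 2 ^ w = 1 by rewrite modn_small //; lia.
suff loop m : m <= n -> exists2 t, t <= m * (cost p n + 8) + 4 &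
  exec w (While (Op Lt (Reg i) (Reg 0))
    (Seq (compile p) (Assign i (Op Add (Reg i) (Const 1)))))
    (set_reg (iteri (n - m) F s) i (n - m)) t (set_reg (iteri n F s) i n).
  have [t le_t] := loop n (leqnn n); rewrite subnn /= => ex_t.
  exists (2 + t); first by rewrite addnC; move: le_t; clear; lia.
  apply: ExecSeq ex_t; have := ExecAssign w i (Const 0) s.
  by rewrite /= mod0n.
elim: m => [|m IHm] le_mn.
  exists 4; rewrite // subn0; apply: (@ExecWhileFalse w (Op Lt (Reg i) (Reg 0))).
  by rewrite /= /update eqxx i0' F0 ltnn.
have [t le_t ex_t] := IHm (ltnW le_mn).
have [] := IH (set_reg (iteri (n - m.+1) F s) i (n - m.+1)) wfp.
  by rewrite /= /update i0' F0.
have -> : reg (set_reg (iteri (n - m.+1) F s) i (n - m.+1)) 0 = n.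
  by rewrite /= /update i0' F0.
move=> tb le_tb ex_tb; exists (3 + (tb + 4) + t).+1.
  by move: le_t le_tb; clear; lia.
have nm : (n - m.+1).+1 = n - m by rewrite subnSK.
apply: (@ExecWhileTrue w (Op Lt (Reg i) (Reg 0)) _ _ _ _ (tb + 4) t) ex_t.
  by rewrite /= /update eqxx i0' F0 -subn_gt0 subKn.
apply: ExecSeq ex_tb _.
have := ExecAssign w i (Op Add (Reg i) (Const 1)) (iteri (n - m) F s).
have Ri : reg (iteri (n - m) F s) i = n - m.+1 by rewrite -nm Fi.
rewrite /= w1 Ri !addn1 nm modn_small; last first.
  by apply: leq_ltn_trans hw; rewrite leqW // leq_subr.
by rewrite -{1}nm.
Qed.

Lemma cost_bound p : exists c, forall n, 0 < n -> cost p n <= c * n ^ depth p.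
Proof.
elim: p => [r e|a e|p1 [c1 IH1] p2 [c2 IH2]|i p [c IH]] /=.
- by exists (expr_cost e).+1 => n _; rewrite muln1.
- by exists (expr_cost a + expr_cost e).+1 => n _; rewrite muln1.
- exists (c1 + c2) => n n0; rewrite mulnDl leq_add //.
    by apply: leq_trans (IH1 n n0) _; rewrite leq_mul2l leq_pexp2l ?leq_maxl ?orbT.
  by apply: leq_trans (IH2 n n0) _; rewrite leq_mul2l leq_pexp2l ?leq_maxr ?orbT.
exists (c + 14) => n n0; have := IH n n0; rewrite expnS.
have : 0 < n ^ depth p by rewrite expn_gt0 n0.
by move: (n ^ _) (cost p n) => e k; clear IH; nia.
Qed.

(** * The algorithm *)

Definition eNot e := Op Eq e (Const 0).
Definition eAnd e1 e2 := Op Mul e1 e2.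
Definition eOr e1 e2 := Op Lt (Const 0) (Op Add e1 e2).
Definition ePos e := Op Lt (Const 0) e.
Definition eAdj a b := Read (Op Add (Op Mul (Reg a) (Reg 0)) (Reg b)).
(* Memory is a table with rows of length [n]: the adjacency matrix comes first, and
   row [n + k] holds [lev v k] for [k <= 5], [top v] for [k = 6], the vertices of
   solved components for [k = 7], and [violated v x] for [k = 8].  Registers 1, 2, 3
   and 4 hold [v], [x] and the two inner loop indices. *)
Definition eAddr k a :=
  Op Add (Op Mul (Op Add (Reg 0) (Const k)) (Reg 0)) (Reg a).
Definition eArr k a := Read (eAddr k a).

Definition count_into acc c :=
  PSeq (PAssign acc (Const 0))
       (PFor 4 (PAssign acc (Op Add (Reg acc) c))).

Definition fill_row k c e :=
  PFor 3 (PSeq (count_into 5 c) (PWrite (eAddr k 3) e)).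

Definition level_step r :=
  fill_row r.+1 (eAnd (Op Eq (eArr r 4) (Const r.+1)) (eAdj 4 3))
    (Op Add (eArr r 3)
            (Op Mul (eAnd (eNot (eArr r 3)) (ePos (Reg 5))) (Const r.+2))).

Fixpoint level_prog r :=
  if r is r'.+1 then PSeq (level_prog r') (level_step r')
  else fill_row 0 (Const 0) (Op Eq (Reg 3) (Reg 1)).

Definition top_prog :=
  fill_row 6
    (eAnd (eAdj 3 4) (Op Eq (eArr 5 4) (Op Add (eArr 5 3) (Const 1))))
    (eAnd (Op Lt (Const 3) (eArr 5 3)) (eNot (Reg 5))).

Definition check_prog :=
  PSeq (fill_row 8
         (eAnd (eOr (Op Eq (Reg 3) (Reg 4)) (eAdj 3 4))
               (eOr (eOr (Op Eq (Reg 4) (Reg 1)) (Op Eq (Reg 4) (Reg 2)))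
                    (eAnd (eArr 6 4) (eNot (eAdj 4 2)))))
         (eAnd (ePos (eArr 5 3)) (eNot (Op Eq (Reg 5) (Const 1)))))
  (PSeq (count_into 6 (eArr 8 4))
        (fill_row 7 (Const 0)
           (eOr (eArr 7 3) (eAnd (eNot (Reg 6)) (ePos (eArr 5 3)))))).

Definition search_prog :=
  PFor 1 (PSeq (PSeq (level_prog 5) top_prog) (PFor 2 check_prog)).

Definition eds_prog := PSeq search_prog (count_into 5 (eNot (eArr 7 4))).

Section Correctness.

Variables (n w : nat).
Hypothesis hw : (n + 9) * n.+1 <= 2 ^ w.

Lemma small_word x : x < n + 9 -> x < 2 ^ w.
Proof. by move=> hx; apply: leq_trans hw; apply: leq_trans hx _; rewrite leq_pmulr. Qed.

Lemma address_word k j : k <= 8 -> j < n -> (n + k) * n + j < 2 ^ w.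
Proof. by move=> k8 jn; apply: leq_trans hw; nia. Qed.

Definition mem_cell (s : state) r j := Defs.mem s (r * n + j).

Section Expr.

Variable s : state.
Hypothesis s0 : reg s 0 = n.

Lemma eval_const c : c <= 8 -> eval w s (Const c) = c.
Proof. by move=> c8; rewrite /= modn_small // small_word // (leq_trans _ (leq_addl n 9)). Qed.

Lemma eval_reg r x : reg s r = x -> eval w s (Reg r) = x. Proof. by []. Qed.

Lemma eval_eq e1 e2 x y : eval w s e1 = x -> eval w s e2 = y ->
  eval w s (Op Eq e1 e2) = (x == y).
Proof. by move=> /= -> ->. Qed.

Lemma eval_lt e1 e2 x y : eval w s e1 = x -> eval w s e2 = y ->
  eval w s (Op Lt e1 e2) = (x < y).
Proof. by move=> /= -> ->. Qed.

Lemma eval_add e1 e2 x y : eval w s e1 = x -> eval w s e2 = y -> x + y < n + 9 ->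
  eval w s (Op Add e1 e2) = x + y.
Proof. by move=> /= -> -> xy; rewrite modn_small // small_word. Qed.

Lemma eval_mul e1 e2 x y : eval w s e1 = x -> eval w s e2 = y -> x * y < n + 9 ->
  eval w s (Op Mul e1 e2) = x * y.
Proof. by move=> /= -> -> xy; rewrite modn_small // small_word. Qed.

Lemma eval_not e x : eval w s e = x -> eval w s (eNot e) = (x == 0).
Proof. by move=> ex; apply: eval_eq; rewrite // eval_const. Qed.

Lemma eval_pos e x : eval w s e = x -> eval w s (ePos e) = (0 < x).
Proof. by move=> ex; apply: eval_lt; rewrite // eval_const. Qed.

Lemma eval_and e1 e2 (b1 b2 : bool) : eval w s e1 = b1 -> eval w s e2 = b2 ->
  eval w s (eAnd e1 e2) = b1 && b2.
Proof.
move=> /= -> ->; rewrite mulnb modn_small // small_word //.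
by rewrite (leq_ltn_trans (leq_b1 _)) // addnC.
Qed.

Lemma eval_or e1 e2 (b1 b2 : bool) : eval w s e1 = b1 -> eval w s e2 = b2 ->
  eval w s (eOr e1 e2) = b1 || b2.
Proof.
move=> e1b e2b; rewrite (@eval_pos _ (b1 + b2)); first by case: b1 {e1b}; case: b2 {e2b}.
by apply: eval_add => //; case: b1 {e1b}; case: b2 {e2b}; rewrite [n + _]addnC.
Qed.

Lemma eval_adj a b i j : reg s a = i -> reg s b = j -> i < n -> j < n ->
  eval w s (eAdj a b) = mem_cell s i j.
Proof.
move=> /= -> -> i_n j_n; rewrite s0 /mem_cell.
have lt := address_word (isT : 0 <= 8) j_n.
have lt' : i * n + j < 2 ^ w by apply: leq_ltn_trans lt; rewrite leq_add2r leq_mul2r addn0 ltnW ?orbT.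
by rewrite !modn_small // (leq_ltn_trans _ lt') // leq_addr.
Qed.

Lemma eval_addr k a j : reg s a = j -> k <= 8 -> j < n ->
  eval w s (eAddr k a) = (n + k) * n + j.
Proof.
move=> /= -> k8 j_n; rewrite s0.
have lt := address_word k8 j_n.
rewrite [k %% _]modn_small; last by rewrite small_word //; lia.
rewrite [(n + k) %% _]modn_small; last by rewrite small_word //; lia.
by rewrite !modn_small // (leq_ltn_trans _ lt) // leq_addr.
Qed.

Lemma eval_arr k a j : reg s a = j -> k <= 8 -> j < n ->
  eval w s (eArr k a) = mem_cell s (n + k) j.
Proof. by move=> sa k8 jn; rewrite /mem_cell -(eval_addr sa k8 jn). Qed.

End Expr.

Lemma cell_write s r c x r' c' : c < n -> c' < n ->
  mem_cell (set_mem s (r * n + c) x) r' c' =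
  if (r' == r) && (c' == c) then x else mem_cell s r' c'.
Proof.
move=> cn c'n; rewrite /mem_cell /= /update; congr (if _ then _ else _).
have n0 : 0 < n by apply: leq_ltn_trans cn.
apply/eqP/andP => [E|[/eqP-> /eqP-> //]].
have := congr1 (divn^~ n) E; rewrite !divnMDl // !divn_small // !addn0 => ->.
by have := congr1 (modn^~ n) E; rewrite !modnMDl !modn_small // => ->.
Qed.

Lemma run_count_into acc c (C : nat -> bool) s : reg s 0 = n ->
  acc != 4 -> acc != 0 ->
  (forall i s', i < n -> Defs.mem s' = Defs.mem s ->
     (forall r, r != 4 -> r != acc -> reg s' r = reg s r) -> reg s' 4 = i ->
     eval w s' c = C i) ->
  reg (run w (count_into acc c) s) acc = count C (iota 0 n) /\
  Defs.mem (run w (count_into acc c) s) = Defs.mem s.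
Proof.
move=> s0 acc4 acc0 cC; pose s1 := set_reg s acc 0.
pose F k s' := run w (PAssign acc (Op Add (Reg acc) c)) (set_reg s' 4 k).
have -> : run w (count_into acc c) s = set_reg (iteri n F s1) 4 n.
  have E : update (reg s) acc 0 0 = n by rewrite /update eq_sym (negbTE acc0).
  by rewrite /= mod0n E.
suff inv m : m <= n -> [/\ reg (iteri m F s1) acc = count C (iota 0 m),
  Defs.mem (iteri m F s1) = Defs.mem s &
  (forall r, r != 4 -> r != acc -> reg (iteri m F s1) r = reg s r)].
  have [Ha Hm _] := inv n (leqnn n).
  by rewrite /= /update (negbTE acc4).
elim: m => [|m IHm] mn.
  split=> //=; first by rewrite /update eqxx.
  by move=> r _ racc; rewrite /= /update (negbTE racc).
have [IHa IHmem IHr] := IHm (ltnW mn).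
have Em : eval w (set_reg (iteri m F s1) 4 m) c = C m.
  apply: cC => // r r4 racc.
  by rewrite /= /update (negbTE r4) IHr.
split.
- have -> : count C (iota 0 m.+1) = count C (iota 0 m) + C m.
    by rewrite -addn1 iotaD count_cat /= addn0.
  rewrite /= /F /= -/F Em /update eqxx (negbTE acc4) IHa modn_small //.
  apply: small_word; have := count_size C (iota 0 m); rewrite size_iota.
  by case: (C m) => /=; lia.
- by rewrite /= /F /= -/F IHmem.
- by move=> r r4 racc; rewrite /= /F /= -/F /update (negbTE racc) (negbTE r4) IHr.
Qed.

Definition agrees (R K : seq nat) (s s' : state) :=
  [/\ forall r, r \notin R -> reg s' r = reg s r,
      forall i j, i < n -> j < n -> mem_cell s' i j = mem_cell s i j &
      forall k j, k \notin K -> j < n -> mem_cell s' (n + k) j = mem_cell s (n + k) j].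

Lemma agrees_trans R1 R2 R K1 K2 K s1 s2 s3 :
  agrees R1 K1 s1 s2 -> agrees R2 K2 s2 s3 ->
  all [in R] (R1 ++ R2) -> all [in K] (K1 ++ K2) -> agrees R K s1 s3.
Proof.
case=> [r12 a12 k12] [r23 a23 k23]; rewrite !all_cat.
move=> /andP[/allP sR1 /allP sR2] /andP[/allP sK1 /allP sK2]; split=> [r rR|i j i_n j_n|k j kK j_n].
- by rewrite r23 ?r12 //; apply: contra rR; [exact: sR1 | exact: sR2].
- by rewrite a23 // a12.
- by rewrite k23 ?k12 //; apply: contra kK; [exact: sK1 | exact: sK2].
Qed.

Lemma run_fill_row k c e (C : nat -> nat -> bool) (F : nat -> nat) s :
  reg s 0 = n -> k <= 8 ->
  (forall j i s', j < n -> i < n -> agrees [:: 3; 4; 5] [:: k] s s' ->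
     reg s' 3 = j -> reg s' 4 = i -> eval w s' c = C j i) ->
  (forall j s', j < n -> agrees [:: 3; 4; 5] [:: k] s s' ->
     reg s' 3 = j -> reg s' 5 = count (C j) (iota 0 n) ->
     mem_cell s' (n + k) j = mem_cell s (n + k) j -> eval w s' e = F j) ->
  agrees [:: 3; 4; 5] [:: k] s (run w (fill_row k c e) s) /\
  (forall j, j < n -> mem_cell (run w (fill_row k c e) s) (n + k) j = F j).
Proof.
move=> s0 k8 cC eF.
pose B := PSeq (count_into 5 c) (PWrite (eAddr k 3) e).
pose T m s' := run w B (set_reg s' 3 m).
suff inv m : m <= n -> agrees [:: 3; 4; 5] [:: k] s (iteri m T s) /\
    (forall j, j < n -> mem_cell (iteri m T s) (n + k) j =
                        if j < m then F j else mem_cell s (n + k) j).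
  have [Ha Hc] := inv n (leqnn n).
  have -> : run w (fill_row k c e) s = set_reg (iteri n T s) 3 n by rewrite /= s0.
  split; last by move=> j jn; rewrite -[LHS]/(mem_cell (iteri n T s) _ _) Hc // jn.
  case: Ha => Hr Hadj Hk; split=> // r rR; rewrite /= /update.
  by case: eqP rR => [->|_ rR] //; apply: Hr.
elim: m => [|m IHm] mn.
  by split=> //; split.
have [Ha Hc] := IHm (ltnW mn); set sm := iteri m T s in Ha Hc.
have Ha3 x : agrees [:: 3; 4; 5] [:: k] s (set_reg sm 3 x).
  case: Ha => Hr Hadj Hk; split=> // r rR; rewrite /= /update.
  by case: eqP rR => [->|_ rR] //; apply: Hr.
have sm0 : reg (set_reg sm 3 m) 0 = n by case: (Ha3 m) => /(_ 0 isT) ->.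
pose sc := run w (count_into 5 c) (set_reg sm 3 m).
have [||i s' i_n mem' reg' s4 | sc5 scm] := @run_count_into 5 c (C m) (set_reg sm 3 m) sm0 => //.
  apply: cC => //; last by rewrite reg' //= /update.
  case: (Ha3 m) => Hr Hadj Hk; split=> [r|i' j|k' j]; rewrite /mem_cell ?mem'; try by [apply: Hadj | apply: Hk].
  rewrite !inE !negb_or => /and3P[r3 r4 r5]; rewrite reg' //.
  by rewrite Hr // !inE !negb_or r3 r4.
rewrite -/sc in sc5 scm.
have regc r : r \notin [:: 4; 5] -> reg sc r = reg (set_reg sm 3 m) r.
  by move=> rR; apply: run_frame; rewrite /= !inE; move: rR; rewrite !inE !negb_or => /andP[-> ->].
have agc : agrees [:: 3; 4; 5] [:: k] s sc.
  case: (Ha3 m) => Hr Hadj Hk; split=> [r|i' j|k' j]; rewrite /mem_cell ?scm; try by [apply: Hadj | apply: Hk].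
  rewrite !inE !negb_or => /and3P[r3 r4 r5]; rewrite regc ?inE ?negb_or ?r4 ?r5 //.
  by rewrite Hr // !inE !negb_or r3 r4.
have sc3 : reg sc 3 = m by rewrite regc.
have sc0 : reg sc 0 = n by rewrite regc.
have Ee : eval w sc e = F m.
  apply: eF => //; rewrite /mem_cell scm -[LHS]/(mem_cell sm (n + k) m) Hc // ltnn //.
have -> : iteri m.+1 T s = set_mem sc ((n + k) * n + m) (F m).
  by rewrite -Ee -(eval_addr sc0 sc3 k8 mn).
split.
  case: agc => Hr Hadj Hk; split=> [r rR|i j i_n j_n|k' j k'K j_n]; first exact: Hr.
    rewrite cell_write // -{1}(addn0 i) ifF ?Hadj //.
    by rewrite addn0 ltn_eqF // ltn_addr.
  by rewrite cell_write // eqn_add2l ifF ?Hk //; move: k'K; rewrite inE => /negbTE->.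
move=> j jn; rewrite cell_write // eqxx /= ltnS leq_eqVlt.
case: eqP => [->|_] //=.
by rewrite /mem_cell scm -[LHS]/(mem_cell sm (n + k) j) Hc.
Qed.

End Correctness.

Section Search.

Variables (n : nat) (g : nat -> nat -> bool).

(* [lev v r j] is one plus the distance from [v] to [j] if that distance is at most
   [r], and 0 otherwise. *)
Fixpoint lev (v r j : nat) : nat :=
  if r is r'.+1 then
    if lev v r' j != 0 then lev v r' j
    else if 0 < count (fun i => (lev v r' i == r) && g i j) (iota 0 n)
    then r.+1 else 0
  else (j == v).

Definition top v j : bool :=
  (3 < lev v 5 j) &&
  (count (fun i => g j i && (lev v 5 i == (lev v 5 j).+1)) (iota 0 n) == 0).

Definition candidate v x b : bool := [|| b == v, b == x | top v b && ~~ g b x].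

Definition violated v x a : bool :=
  (0 < lev v 5 a) &&
  (count (fun b => ((a == b) || g a b) && candidate v x b) (iota 0 n) != 1).

Definition good v x : bool := count (violated v x) (iota 0 n) == 0.

Definition solved a : bool :=
  has (fun v => has (fun x => good v x && (0 < lev v 5 a)) (iota 0 n)) (iota 0 n).

Lemma lev_le v r j : lev v r j <= r.+1.
Proof.
elim: r => [|r IHr] /=; first exact: leq_b1.
by case: ifP => _; [exact: leqW | case: ifP].
Qed.

Variable w : nat.
Hypothesis hw : (n + 9) * n.+1 <= 2 ^ w.

Local Notation cell := (mem_cell n).
Local Notation agrees := (agrees n).

Definition graph_rows s := forall i j, i < n -> j < n -> cell s i j = g i j.

Lemma agrees_graph_rows R K s s' : graph_rows s -> agrees R K s s' -> graph_rows s'.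
Proof. by move=> gs [_ Ha _] i j i_n j_n; rewrite Ha // gs. Qed.

Lemma agrees_reg R K s s' r x : agrees R K s s' -> reg s r = x ->
  r \notin R -> reg s' r = x.
Proof. by case=> Hr _ _ <- /Hr. Qed.

Lemma run_level_prog r v s : r <= 5 -> reg s 0 = n -> reg s 1 = v -> graph_rows s ->
  agrees [:: 3; 4; 5] (iota 0 r.+1) s (run w (level_prog r) s) /\
  (forall j, j < n -> cell (run w (level_prog r) s) (n + r) j = lev v r j).
Proof.
move=> r5 s0 s1 gs; elim: r r5 => [|r IHr] r5.
  apply: (run_fill_row hw (C := fun _ _ => false)) => //.
    by move=> j i s' *; rewrite (eval_const hw).
  move=> j s' j_n ag s3 _ _; apply: eval_eq => //.
  exact: agrees_reg ag s1 _.
have [ag1 c1] := IHr (ltnW r5); rewrite /level_prog -/level_prog.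
set s2 := run w (level_prog r) s in ag1 c1 *.
have gs2 := agrees_graph_rows gs ag1.
have s20 : reg s2 0 = n by apply: agrees_reg ag1 s0 _.
have rr1 : r \notin [:: r.+1] by rewrite inE ltn_eqF.
have r8 : r <= 8 by apply: leq_trans (ltnW r5) _.
have [|||ag2 c2] := @run_fill_row n w hw r.+1
  (eAnd (Op Eq (eArr r 4) (Const r.+1)) (eAdj 4 3))
    (Op Add (eArr r 3)
            (Op Mul (eAnd (eNot (eArr r 3)) (ePos (Reg 5))) (Const r.+2)))
  (fun j i => (lev v r i == r.+1) && g i j) (lev v r.+1) s2 s20.
- by apply: leq_trans r5 _.
- move=> j i s' j_n i_n ag s3 s4; have s'0 := agrees_reg ag s20 isT.
  apply: (eval_and hw).
    apply: eval_eq; last by rewrite (eval_const hw) //; apply: leq_trans r5 _.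
    rewrite (eval_arr hw s'0 s4) //.
    by case: ag => _ _ ->; rewrite // c1.
  by rewrite (eval_adj hw s'0 s4 s3) // (agrees_graph_rows gs2 ag).
- move=> j s' j_n ag s3 s5 _; have s'0 := agrees_reg ag s20 isT.
  have Ej : eval w s' (eArr r 3) = lev v r j.
    by rewrite (eval_arr hw s'0 s3) //; case: ag => _ _ ->; rewrite // c1.
  have E1 : eval w s' (eAnd (eNot (eArr r 3)) (ePos (Reg 5))) =
            (lev v r j == 0) && (0 < reg s' 5).
    by apply: (eval_and hw); [apply: (eval_not hw) | apply: (eval_pos hw)].
  have r28 : r.+2 <= 8 by move: r5; clear; lia.
  have Ec : eval w s' (Const r.+2) = r.+2 by rewrite (eval_const hw).
  have E2 : eval w s' (Op Mul (eAnd (eNot (eArr r 3)) (ePos (Reg 5))) (Const r.+2)) =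
     ((lev v r j == 0) && (0 < reg s' 5)) * r.+2.
    apply: (eval_mul hw) => //; apply: leq_trans (leq_addl n 9).
    by case: (_ && _); rewrite ?mul1n ?mul0n.
  have bnd := lev_le v r j.
  rewrite (@eval_add n w hw _ _ _ (lev v r j) _ Ej E2).
    rewrite /= s5; case: eqP => [->|_] /=; last by rewrite mul0n addn0.
    by case: (0 < _); rewrite ?mul1n ?mul0n.
  case: eqP => [->|_] /=; last by move: bnd r5; clear; lia.
  by case: (0 < _) => /=; move: r5; clear; lia.
split=> //.
apply: agrees_trans ag1 ag2 _ _ => //; apply/allP => x.
rewrite mem_cat mem_seq1 mem_iota leq0n add0n => x_r.
suff : x \in iota 0 r.+2 by [].
by rewrite mem_iota leq0n add0n /=; case/orP: x_r => [/leqW|/eqP->]; rewrite ?ltnS // ltnW.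
Qed.

Lemma run_top_prog v s : reg s 0 = n -> graph_rows s ->
  (forall j, j < n -> cell s (n + 5) j = lev v 5 j) ->
  agrees [:: 3; 4; 5] [:: 6] s (run w top_prog s) /\
  (forall j, j < n -> cell (run w top_prog s) (n + 6) j = top v j).
Proof.
move=> s0 gs c5.
have E5 s' a j : j < n -> agrees [:: 3; 4; 5] [:: 6] s s' -> reg s' a = j ->
    eval w s' (eArr 5 a) = lev v 5 j.
  move=> j_n ag sa; rewrite (eval_arr hw (agrees_reg ag s0 isT) sa) //.
  by case: ag => _ _ ->; rewrite ?c5.
apply: (run_fill_row hw (C := fun j i => g j i && (lev v 5 i == (lev v 5 j).+1))) => //.
  move=> j i s' j_n i_n ag s3 s4; have s'0 := agrees_reg ag s0 isT.
  apply: (eval_and hw); first by rewrite (eval_adj hw s'0 s3 s4) // (agrees_graph_rows gs ag).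
  apply: eval_eq; first exact: E5.
  rewrite -[(lev v 5 j).+1]addn1; apply: (eval_add hw); [exact: E5 | by rewrite (eval_const hw) |].
  by have := lev_le v 5 j; clear; lia.
move=> j s' j_n ag s3 s5 _; apply: (eval_and hw).
  by apply: eval_lt; [rewrite (eval_const hw) | exact: E5].
exact: (eval_not hw).
Qed.

Lemma run_check_prog v x s (K : nat -> bool) : reg s 0 = n -> reg s 1 = v ->
  reg s 2 = x -> x < n -> graph_rows s ->
  (forall j, j < n -> cell s (n + 5) j = lev v 5 j) ->
  (forall j, j < n -> cell s (n + 6) j = top v j) ->
  (forall j, j < n -> cell s (n + 7) j = K j) ->
  agrees [:: 3; 4; 5; 6] [:: 7; 8] s (run w check_prog s) /\
  (forall j, j < n ->
     cell (run w check_prog s) (n + 7) j = K j || (good v x && (0 < lev v 5 j))).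
Proof.
move=> s0 s1 s2 x_n gs c5 c6 c7; rewrite /check_prog.
have arrE R k f t s' a j : agrees R t s s' -> 0 \notin R -> k \notin t -> k <= 8 ->
    (forall j, j < n -> cell s (n + k) j = f j) -> j < n -> reg s' a = j ->
    eval w s' (eArr k a) = f j.
  move=> ag R0 kt k8 ck j_n sa; rewrite (eval_arr hw (agrees_reg ag s0 R0) sa) //.
  by case: ag => _ _ ->; rewrite ?ck.
set p1 := fill_row 8 _ _; set p2 := count_into 6 _; set p3 := fill_row 7 _ _.
have [ag1 d8] : agrees [:: 3; 4; 5] [:: 8] s (run w p1 s) /\
    (forall j, j < n -> cell (run w p1 s) (n + 8) j = violated v x j).
  apply: (run_fill_row hw
    (C := fun a b => ((a == b) || g a b) && candidate v x b)) => //.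
    move=> a b s' a_n b_n ag s3 s4; have s'0 := agrees_reg ag s0 isT.
    have gs' := agrees_graph_rows gs ag.
    have s'1 := agrees_reg ag s1 isT; have s'2 := agrees_reg ag s2 isT.
    rewrite /candidate orbA; do 2?[apply: (eval_and hw) | apply: (eval_or hw)].
    + exact: eval_eq.
    + by rewrite (eval_adj hw s'0 s3 s4) // gs'.
    + by apply: (eval_or hw); apply: eval_eq.
    + apply: (eval_and hw); first exact: (arrE _ _ _ _ _ _ _ ag _ _ _ c6).
      rewrite -eqb0; apply: (eval_not hw).
      by rewrite (eval_adj hw s'0 s4 s'2) // gs'.
  move=> a s' a_n ag s3 s5 _; apply: (eval_and hw).
    by apply: (eval_pos hw); apply: (arrE _ _ _ _ _ _ _ ag _ _ _ c5).
  rewrite -eqb0; apply: (eval_not hw); apply: eval_eq => //.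
  by rewrite (eval_const hw).
rewrite -[run w (PSeq _ _) s]/(run w p3 (run w p2 (run w p1 s))).
set t1 := run w p1 s in ag1 d8 *; set t2 := run w p2 t1.
have t10 := agrees_reg ag1 s0 isT.
have [d6 m2] : reg t2 6 = count (violated v x) (iota 0 n) /\
    Defs.mem t2 = Defs.mem t1.
  apply: (run_count_into hw) => // i s' i_n ms rs s4.
  have s'0 : reg s' 0 = n by rewrite rs.
  by rewrite (eval_arr hw s'0 s4) // /mem_cell ms -[LHS]/(cell t1 _ _) d8.
have ag2 : agrees [:: 3; 4; 5; 6] [:: 8] s t2.
  case: ag1 => Hr Ha Hk; split=> [r rR|i j i_n j_n|k j kK j_n].
  - rewrite /t2 run_frame ?Hr //; move: rR; rewrite /= !inE !negb_or;
      by case/and4P=> ? ? ? ?; do ?[apply/andP; split].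
  - by rewrite /mem_cell m2; apply: Ha.
  - by rewrite /mem_cell m2; apply: Hk.
have t20 := agrees_reg ag2 s0 isT.
have [ag3 d7] : agrees [:: 3; 4; 5] [:: 7] t2 (run w p3 t2) /\
    (forall j, j < n ->
       cell (run w p3 t2) (n + 7) j = K j || (good v x && (0 < lev v 5 j))).
  apply: (run_fill_row hw (C := fun _ _ => false)) => //.
    by move=> *; rewrite (eval_const hw).
  move=> j s' j_n ag s3 _ c7j.
  have ag' : agrees [:: 3; 4; 5; 6] [:: 7; 8] s s'.
    by apply: agrees_trans ag2 ag _ _.
  apply: (eval_or hw).
    rewrite (eval_arr hw (agrees_reg ag' s0 isT) s3) // c7j.
    by case: ag2 => _ _ ->; rewrite ?c7.
  apply: (eval_and hw).
    by apply: (eval_not hw); apply: agrees_reg ag d6 _.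
  by apply: (eval_pos hw); apply: (arrE _ _ _ _ _ _ _ ag' _ _ _ c5).
split=> //.
by apply: agrees_trans ag2 ag3 _ _.
Qed.

Lemma has_iotaS (P : pred nat) m : has P (iota 0 m.+1) = has P (iota 0 m) || P m.
Proof. by rewrite -addn1 iotaD has_cat /= orbF. Qed.

Lemma run_check_loop v s (K : nat -> bool) : reg s 0 = n -> reg s 1 = v ->
  graph_rows s ->
  (forall j, j < n -> cell s (n + 5) j = lev v 5 j) ->
  (forall j, j < n -> cell s (n + 6) j = top v j) ->
  (forall j, j < n -> cell s (n + 7) j = K j) ->
  agrees [:: 2; 3; 4; 5; 6] [:: 7; 8] s (run w (PFor 2 check_prog) s) /\
  (forall j, j < n -> cell (run w (PFor 2 check_prog) s) (n + 7) j =
     K j || has (fun x => good v x && (0 < lev v 5 j)) (iota 0 n)).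
Proof.
move=> s0 s1 gs c5 c6 c7.
pose T m s' := run w check_prog (set_reg s' 2 m).
have reg2 (R : seq nat) t x s' : 2 \in R -> agrees R t s s' -> agrees R t s (set_reg s' 2 x).
  move=> R2 [Hr Ha Hk]; split=> // r rR; rewrite /= /update.
  by case: eqP rR => [->|_ rR]; [rewrite R2 | apply: Hr].
suff inv m : m <= n -> agrees [:: 2; 3; 4; 5; 6] [:: 7; 8] s (iteri m T s) /\
    (forall j, j < n -> cell (iteri m T s) (n + 7) j =
       K j || has (fun x => good v x && (0 < lev v 5 j)) (iota 0 m)).
  have [Ha Hc] := inv n (leqnn n).
  have -> : run w (PFor 2 check_prog) s = set_reg (iteri n T s) 2 n.
    by rewrite -[LHS]/(set_reg (iteri (reg s 0) T s) 2 (reg s 0)) s0.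
  by split; [exact: reg2 | exact: Hc].
elim: m => [|m IHm] mn; first by split=> // j jn; rewrite orbF c7.
have [Ha Hc] := IHm (ltnW mn); set sm := iteri m T s in Ha Hc.
have ag := reg2 [:: 2; 3; 4; 5; 6] _ m _ isT Ha.
have [||||||||ag1 c1] := @run_check_prog v m (set_reg sm 2 m)
  (fun j => K j || has (fun x => good v x && (0 < lev v 5 j)) (iota 0 m)).
- exact: agrees_reg ag s0 isT.
- exact: agrees_reg ag s1 isT.
- by [].
- exact: mn.
- exact: agrees_graph_rows gs ag.
- by move=> j jn; case: ag => _ _ ->; rewrite ?c5.
- by move=> j jn; case: ag => _ _ ->; rewrite ?c6.
- exact: Hc.
split; first exact: agrees_trans ag ag1 _ _.
by move=> j jn; rewrite has_iotaS orbA -c1.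
Qed.

Lemma run_search_prog s : reg s 0 = n -> graph_rows s ->
  (forall j, j < n -> cell s (n + 7) j = 0) ->
  reg (run w search_prog s) 0 = n /\
  (forall j, j < n -> cell (run w search_prog s) (n + 7) j = solved j).
Proof.
move=> s0 gs c7.
pose B := PSeq (PSeq (level_prog 5) top_prog) (PFor 2 check_prog).
pose T m s' := run w B (set_reg s' 1 m).
pose K m j := has (fun v => has (fun x => good v x && (0 < lev v 5 j)) (iota 0 n)) (iota 0 m).
suff inv m : m <= n -> [/\ reg (iteri m T s) 0 = n, graph_rows (iteri m T s) &
    (forall j, j < n -> cell (iteri m T s) (n + 7) j = K m j)].
  have [H0 _ Hc] := inv n (leqnn n).
  have -> : run w search_prog s = set_reg (iteri n T s) 1 n.
    by rewrite -[LHS]/(set_reg (iteri (reg s 0) T s) 1 (reg s 0)) s0.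
  by split; [exact: H0 | exact: Hc].
elim: m => [|m IHm] mn; first by split.
have [H0 Hg Hc] := IHm (ltnW mn); set sm := set_reg (iteri m T s) 1 m.
have sm0 : reg sm 0 = n by [].
have sm1 : reg sm 1 = m by [].
have smg : graph_rows sm by [].
have [ag1 c5] := run_level_prog (isT : 5 <= 5) sm0 sm1 smg.
set t1 := run w (level_prog 5) sm in ag1 c5.
have t10 := agrees_reg ag1 sm0 isT; have t11 := agrees_reg ag1 sm1 isT.
have t1g := agrees_graph_rows smg ag1.
have [ag2 c6] := run_top_prog t10 t1g c5.
set t2 := run w top_prog t1 in ag2 c6.
have t20 := agrees_reg ag2 t10 isT; have t21 := agrees_reg ag2 t11 isT.
have t2g := agrees_graph_rows t1g ag2.
have [||ag3 c3] := run_check_loop (K := K m) t20 t21 t2g _ c6.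
- by move=> j jn; case: ag2 => _ _ ->; rewrite ?c5.
- move=> j jn; case: ag2 => _ _ -> //; case: ag1 => _ _ -> //; exact: Hc.
have -> : iteri m.+1 T s = run w (PFor 2 check_prog) t2 by [].
split; first exact: agrees_reg ag3 t20 isT.
  exact: agrees_graph_rows t2g ag3.
by move=> j jn; rewrite /K has_iotaS -/(K m j) -c3.
Qed.

Lemma run_eds_prog s : reg s 0 = n -> graph_rows s ->
  (forall j, j < n -> cell s (n + 7) j = 0) ->
  reg (run w eds_prog s) 5 = count (fun j => ~~ solved j) (iota 0 n).
Proof.
move=> s0 gs c7; have [t0 d7] := run_search_prog s0 gs c7.
rewrite -[run w eds_prog s]/(run w (count_into 5 (eNot (eArr 7 4))) (run w search_prog s)).
have [] // := @run_count_into n w hw 5 (eNot (eArr 7 4)) (fun j => ~~ solved j) _ t0.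
move=> i s' i_n ms rs s4; have s'0 : reg s' 0 = n by rewrite rs.
rewrite -eqb0; apply: (eval_not hw).
by rewrite (eval_arr hw s'0 s4) // -d7 // /mem_cell ms.
Qed.

End Search.

(** * Correctness of the search *)

Lemma count_iota_card (n : nat) (P : pred nat) :
  count P (iota 0 n) = #|[set i : 'I_n | P i]|.
Proof. by rewrite cardsE cardE -val_enum_ord count_map -size_filter enumT. Qed.

Lemma count_iota_exists (n : nat) (P : pred nat) :
  (0 < count P (iota 0 n)) = [exists i : 'I_n, P i].
Proof.
rewrite count_iota_card card_gt0; apply/set0Pn/existsP => [] [i];
  by rewrite ?inE; exists i; rewrite ?inE.
Qed.

Section Graph.

Variables (n : nat) (G : graph n).

Definition adjn (i j : nat) : bool :=
  [exists i' : 'I_n, exists j' : 'I_n, (i * n + j == i' * n + j') && G i' j'].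

Lemma adjnE (i j : 'I_n) : adjn i j = G i j.
Proof.
have n0 : 0 < n by apply: leq_ltn_trans (ltn_ord i).
apply/existsP/idP => [[i' /existsP[j' /andP[/eqP E]]]|Gij]; last first.
  by exists i; apply/existsP; exists j; rewrite eqxx.
suff [-> ->] : i = i' /\ j = j' by [].
have := congr1 (divn^~ n) E; have := congr1 (modn^~ n) E.
rewrite !modnMDl !divnMDl // !modn_small // !divn_small // !addn0.
by move=> /val_inj-> /val_inj->.
Qed.

Local Notation lv v r u := (lev n adjn (nat_of_ord v) r (nat_of_ord u)).

Lemma levS (v : 'I_n) r (u : 'I_n) : lv v r.+1 u =
  if lv v r u != 0 then lv v r u
  else if [exists i : 'I_n, (lv v r i == r.+1) && G i u] then r.+2 else 0.
Proof.
rewrite /= count_iota_exists.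
by under eq_existsb do rewrite adjnE.
Qed.

Lemma lev_stable (v u : 'I_n) r : lv v r u != 0 -> lv v r.+1 u = lv v r u.
Proof. by move=> /= ->. Qed.

Lemma lev_edge (v a b : 'I_n) r : G a b -> lv v r a != 0 ->
  0 < lv v r.+1 b <= (lv v r a).+1.
Proof.
move=> ab; elim: r => [|r IHr] La.
  have av : a = v by apply: val_inj; move: La; rewrite [lev _ _ _ _ _]/= eqb0 negbK => /eqP.
  rewrite levS; have [b0|b0] := boolP (lv v 0 b != 0).
    by rewrite lt0n b0 (leq_trans (lev_le _ _ _ _ _)).
  case: existsP => [_|[]]; first by rewrite /= av eqxx.
  by exists a; rewrite ab av /= eqxx.
rewrite levS; have [b0|b0] := boolP (lv v r.+1 b != 0).
  rewrite lt0n b0 andTb.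
  have [a0|a0] := boolP (lv v r a != 0).
    by rewrite (lev_stable a0); case/andP: (IHr a0).
  apply: leq_trans (lev_le _ _ _ _ _) _; move: La; rewrite levS (negbTE a0).
  by case: ifP.
have [a0|a0] := boolP (lv v r a != 0).
  by case/andP: (IHr a0); rewrite lt0n (negbTE b0).
move: La; rewrite [lv v r.+1 a]levS (negbTE a0); case: ifP => // Ea _.
have -> : [exists i : 'I_n, (lv v r.+1 i == r.+2) && G i b]; last exact: leqnn.
by apply/existsP; exists a; rewrite ab levS (negbTE a0) Ea eqxx.
Qed.

Lemma lev_down (v u : 'I_n) r k : lv v r u = k.+2 ->
  exists2 u', G u u' & lv v r u' = k.+1.
Proof.
elim: r => [|r IHr]; first by move=> /=; case: eqP.
rewrite levS; case: ifP => [u0 /IHr[u' uu' Lu']|_].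
  by exists u' => //; rewrite lev_stable Lu'.
case: existsP => // -[i /andP[/eqP Li Giu]] [<-].
by exists i; rewrite ?lev_stable ?Li // adj_sym.
Qed.

Lemma lev_root (v : 'I_n) r : lv v r v = 1.
Proof. by elim: r => [|r IHr]; rewrite ?lev_stable ?IHr //= eqxx. Qed.

Lemma lev_eq1 (v u : 'I_n) r : lv v r u = 1 -> u = v.
Proof.
elim: r => [|r IHr]; first by move=> /= av; apply: val_inj; move: av; case: eqP.
by rewrite levS; case: ifP => // _; case: ifP.
Qed.

Variable A : {set 'I_n}.
Hypothesis bipA : forall u v, G u v -> (u \in A) != (v \in A).
Hypothesis P7free : free (P_ 7) G.

Lemma lev_neq7 (v u : 'I_n) r : lv v r u <> 7.
Proof.
move=> L6.
have [p5 e56 L5] := lev_down L6; have [p4 e45 L4] := lev_down L5.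
have [p3 e34 L3] := lev_down L4; have [p2 e23 L2] := lev_down L3.
have [p1 e12 L1] := lev_down L2; have [p0 e01 L0] := lev_down L1.
have nadj a b i j : lv v r a = i -> lv v r b = j -> i != 0 -> i.+1 < j -> ~~ G b a.
  move=> La Lb i0 ij; rewrite adj_sym; apply/negP => ab.
  rewrite -La in i0; have /andP[_] := lev_edge ab i0.
  have b0 : lv v r b != 0 by rewrite Lb; case: j ij {Lb}.
  by rewrite (lev_stable b0) Lb La leqNgt ij.
apply: (no_P7 bipA P7free e56 e45 e34 e23 e12 e01);
  by apply: nadj; [eassumption | eassumption | |].
Qed.

(* With [r] in place of 5, conversion does not unfold [lev]. *)
Lemma lev_is_level_aux (v : 'I_n) r : r = 5 -> is_level G v (fun u => lv v r u).
Proof.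
move=> r5; split; [exact: lev_root | | by move=> u; exact: lev_eq1
       | by move=> u k; exact: lev_down |].
  by move=> u; apply: leq_trans (lev_le _ _ _ _ _) _; rewrite r5.
move=> a b ab La; have := lev_edge ab La.
have [b0|b0] := boolP (lv v r b != 0); first by rewrite (lev_stable b0).
have := @lev_neq7 v b r.+1; rewrite levS (negbTE b0).
by case: ifP => // _; rewrite r5.
Qed.

Definition lev_is_level (v : 'I_n) : is_level G v (fun u => lv v 5 u) :=
  lev_is_level_aux v erefl.

Definition candidate_set (v x : 'I_n) : {set 'I_n} :=
  [set b : 'I_n | candidate n adjn v x b].

Lemma in_candidate_set (v x b : 'I_n) : (b \in candidate_set v x) =
  [|| b == v, b == x |
   [&& 3 < lv v 5 b, ~~ above G (fun u => lv v 5 u) b & ~~ G b x]].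
Proof.
rewrite inE /candidate /top adjnE -andbA eqn0Ngt count_iota_exists.
suff <- : [exists i : 'I_n, adjn b i && (lv v 5 i == (lv v 5 b).+1)] =
          above G (fun u => lv v 5 u) b by [].
by apply: eq_existsb => i; rewrite adjnE.
Qed.

Lemma goodP (v x : 'I_n) :
  reflect (forall a : 'I_n, lv v 5 a != 0 ->
             #|closed_nbhd G a :&: candidate_set v x| = 1)
          (good n adjn v x).
Proof.
have cardE (a : 'I_n) :
  count (fun b => ((val a == b) || adjn a b) && candidate n adjn v x b) (iota 0 n) =
  #|closed_nbhd G a :&: candidate_set v x|.
  rewrite count_iota_card; apply: eq_card => b.
  by rewrite !inE adjnE eq_sym.
rewrite /good eqn0Ngt count_iota_exists negb_exists.
apply: (iffP forallP) => [H a La|H a].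
  by have := H a; rewrite /violated lt0n La cardE negbK => /eqP.
rewrite /violated lt0n cardE; case: eqP => //= /eqP La.
by rewrite H.
Qed.

Lemma solvedP (a : 'I_n) :
  reflect (exists v x : 'I_n, good n adjn v x /\ connect G v a) (solved n adjn a).
Proof.
apply: (iffP hasP) => [[v + /hasP[x]]|[v [x [gvx va]]]].
  rewrite !mem_iota !leq0n !add0n !andTb => v_n x_n /andP[gvx La].
  exists (Ordinal v_n), (Ordinal x_n); split=> //.
  by rewrite -(level_connect (lev_is_level _)) -lt0n.
exists (val v); first by rewrite mem_iota leq0n add0n ltn_ord.
apply/hasP; exists (val x); first by rewrite mem_iota leq0n add0n ltn_ord.
by rewrite gvx lt0n (level_connect (lev_is_level v)).
Qed.

Lemma has_eds_solved : has_eds G = [forall a : 'I_n, solved n adjn a].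
Proof.
apply/existsP/forallP => [[D edsD] a|allS].
  have [v [x [vD xD va xP]]] := eds_search bipA P7free edsD a lev_is_level.
  apply/solvedP; exists v, x.
  split; last by rewrite -(level_connect (lev_is_level v)).
  apply/goodP => c Lc; rewrite -(eqP (forallP edsD c)).
  apply: eq_card => b; rewrite !in_setI; case: (boolP (b \in closed_nbhd G c)) => //= cb.
  rewrite in_candidate_set (eds_candidate bipA edsD (lev_is_level v) vD xD xP) //.
  move: cb; rewrite inE => /predU1P[->//|cb].
  by case: (lev_is_level v) => _ _ _ _ /(_ c b cb Lc) /andP[]; rewrite lt0n.
pose pk (r : 'I_n) :=
  [pick p : 'I_n * 'I_n | good n adjn p.1 p.2 && connect G p.1 r].
pose D := [set b | if pk (root G b) is Some p then b \in candidate_set p.1 p.2 else false].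
exists D; apply/forallP => a.
have csym := connect_sym_adj G.
case Dp: (pk (root G a)) => [p|]; last first.
  move: Dp; rewrite /pk; case: pickP => // none _.
  have /solvedP[v [x [gvx vr]]] := allS (root G a).
  by have := none (v, x); rewrite /= gvx vr.
have /andP[gp pr] : good n adjn p.1 p.2 && connect G p.1 (root G a).
  by move: Dp; rewrite /pk; case: pickP => // q ? [<-].
have pa : connect G p.1 a.
  by apply: connect_trans pr _; rewrite csym connect_root.
have La : lv p.1 5 a != 0 by rewrite (level_connect (lev_is_level p.1)).
rewrite -(goodP _ _ gp a La); apply/eqP/eq_card => b; rewrite !in_setI.
case: (boolP (b \in closed_nbhd G a)) => //= ab.
rewrite [b \in D]inE; suff -> : root G b = root G a by rewrite Dp.
apply/esym/(rootP csym); move: ab; rewrite inE => /predU1P[->|ab]; first exact: connect0.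
exact: connect1.
Qed.

End Graph.

Lemma word_size_bound n : (n + 9) * n.+1 <= 2 ^ word_size 5 n.
Proof.
rewrite /word_size [5 * _]mulnC expnM.
have h1 : n < 2 ^ (trunc_log 2 n).+1 by apply: trunc_log_ltn.
have h2 : 1 < 2 ^ (trunc_log 2 n).+1 by rewrite -{1}(expn0 2) ltn_exp2l.
move: (2 ^ _) h1 h2 => m h1 h2.
have h3 : n + 9 <= m ^ 4.
  have : 2 ^ 3 <= m ^ 3 by rewrite leq_exp2r.
  by rewrite [m ^ 4]expnS; move: (m ^ 3) h1 h2 => e; rewrite -[2 ^ 3]/8; nia.
by rewrite (expnSr m 4) leq_mul.
Qed.

Theorem theorem4 :
  solvable_in_time
    (fun n (G : graph n) => bipartite G /\ free (P_ 7) G)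
    (fun n (G : graph n) => has_eds G)
    (fun n => n ^ 4).
Proof.
have [c cP] := cost_bound eds_prog.
exists (Seq (compile eds_prog) (Assign 0 (eNot (Reg 5)))), 5,
  (fun n => cost eds_prog n + 4); split=> //; split.
  exists (c + 4), 1 => n n0; rewrite mulnDl leq_add ?cP //.
  by rewrite leq_pmulr // expn_gt0 n0.
move=> n G [[A bipA] P7free].
have hw := word_size_bound n; set w := word_size 5 n in hw *.
have wfE : well_formed eds_prog by [].
have n2 : (reg (input G) 0).+1 < 2 ^ w.
  by apply: leq_trans hw; rewrite /=; nia.
have [t le_t ex_t] := exec_compile wfE n2.
set s := run w eds_prog (input G) in ex_t.
exists (t + 4), (set_reg s 0 (eval w s (eNot (Reg 5)))); split.
- by apply: ExecSeq ex_t _; apply: (ExecAssign w 0 (eNot (Reg 5)) s).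
- by rewrite leq_add2r.
have s5 : reg s 5 = count (fun j => ~~ solved n (adjn G) j) (iota 0 n).
  apply: (run_eds_prog hw) => // j j_n.
  rewrite /mem_cell /= /adj_mem; apply/eqP; rewrite eqb0; apply/existsPn => a.
  apply/existsPn => b; rewrite negb_and; apply/orP; left.
  have := ltn_ord a; have := ltn_ord b; move: (nat_of_ord a) (nat_of_ord b) => x y.
  by rewrite neq_ltn => ? ?; apply/orP; right; nia.
clearbody s; rewrite -[LHS]/(eval w s (eNot (Reg 5))) (eval_not hw (eval_reg w s5)) (has_eds_solved bipA P7free).
rewrite eqn0Ngt count_iota_exists negb_exists.
by congr (nat_of_bool _); apply: eq_forallb => a; rewrite negbK.
Qed.
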